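(* There exist universal numerical constants $c_0,c_1,N_0>0$ such that the following holds. Let $0<u\le c_0$. For any $n_0\ge N_0$ there exists an integer $n\in[n_0/2,2n_0]$ such that, in the model with $V_1,\dots,V_n$ i.i.d. uniform on $[0,1]$, $X_{i,j}=\phi(V_i-V_j)$ with $\phi(x)=u\,\mathbf 1\{|x|\le 1/n\}$, and $Y=X+E$ where $E$ is independent of $(V_1,\dots,V_n)$ and has independent $\mathcal N(0,1)$ entries, every estimator $\hat\Pi$ (a measurable function of $Y$ with values in the set of $n\times n$ permutation matrices) satisfies $$\mathbb E\big[\ell_2(\hat\Pi)\big]\ge c_1u\sqrt n .$$
   Context: For a permutation matrix $\Pi$, $\Pi\cdot M:=\Pi M\Pi^\top$. A symmetric matrix $R\in\mathbb R^{n\times n}$ is Robinson if $R_{i,1}\le\dots\le R_{i,i}\ge\dots\ge R_{i,n}$ for each $i$; $\mathcal R_n$ is the set of such matrices, and $\ell_2(\hat\Pi)=\inf_{R\in\mathcal R_n}\|\hat\Pi\cdot X-R\|_F$, where $\|\cdot\|_F$ is the Frobenius norm. The loss depends on the latent variables $V$ through $X$, and the expectation is over both $V$ and $E$. *)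

(* Defs.v *)
From HB Require Import structures.
From mathcomp Require Import all_boot all_order all_algebra.
From mathcomp Require Import all_classical all_reals all_analysis.

Set Implicit Arguments.
Unset Strict Implicit.
Unset Printing Implicit Defensive.

Import Order.TTheory GRing.Theory Num.Theory.
Import numFieldNormedType.Exports.
Local Open Scope classical_set_scope.
Local Open Scope ring_scope.

(* The sigma-algebra on real matrices generated by the coordinate maps, i.e. the
   Borel one; it also covers random vectors, as 'rV_n is 'M_(1, n). *)
Definition mx_display : measure_display.
Proof. exact: default_measure_display. Qed.

Section matrix_measurable.
Context {R : realType} {m n : nat}.

Definition mx_cylinders : set (set 'M[R]_(m, n)) :=
  [set C | exists i j (A : set R),
     measurable A /\ C = [set M : 'M[R]_(m, n) | A (M i j)]].

Let mx0 : <<s mx_cylinders >> set0.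
Proof. exact: sigma_algebra0. Qed.

Let mxC (A : set 'M[R]_(m, n)) : <<s mx_cylinders >> A ->
  <<s mx_cylinders >> (~` A).
Proof. by move=> mA; rewrite -setTD; exact: sigma_algebraCD. Qed.

Let mx_bigcup (F : (set 'M[R]_(m, n))^nat) :
  (forall i, <<s mx_cylinders >> (F i)) -> <<s mx_cylinders >> (\bigcup_i F i).
Proof. exact: sigma_algebra_bigcup. Qed.

HB.instance Definition _ := @isMeasurable.Build mx_display 'M[R]_(m, n)
  <<s mx_cylinders >> mx0 mxC mx_bigcup.

End matrix_measurable.

Section independence.
Context d (T : measurableType d) (R : realType) (P : probability T R).

Definition mutually_independent (I : finType) (X : I -> T -> R) : Prop :=
  forall (J : {set I}) (A : I -> set R), (forall i, measurable (A i)) ->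
    P (\bigcap_(i in [set` J]) X i @^-1` A i) =
    (\prod_(i in J) P (X i @^-1` A i))%E.

Definition independent d1 (T1 : measurableType d1) d2 (T2 : measurableType d2)
    (X : T -> T1) (Y : T -> T2) : Prop :=
  forall (A : set T1) (B : set T2), measurable A -> measurable B ->
    P (X @^-1` A `&` Y @^-1` B) = (P (X @^-1` A) * P (Y @^-1` B))%E.

End independence.

Definition phi {R : realType} (n : nat) (u x : R) : R :=
  u * \1_[set y : R | `|y| <= n%:R^-1] x.

Section seriation.
Context {R : realType} {n : nat}.

Definition robinson : set 'M[R]_n := [set M |
  [/\ M^T = M,
      (forall i j k : 'I_n, (j <= k)%N -> (k <= i)%N -> M i j <= M i k) &
      (forall i j k : 'I_n, (i <= j)%N -> (j <= k)%N -> M i k <= M i j)]].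

Definition frobenius (M : 'M[R]_n) : R :=
  Num.sqrt (\sum_i \sum_j M i j ^+ 2).

Definition mx_act (Pi M : 'M[R]_n) : 'M[R]_n := Pi *m M *m Pi^T.

Definition ell2 (X Pi : 'M[R]_n) : R :=
  inf [set frobenius (mx_act Pi X - M) | M in robinson].

Definition estimator (Pihat : 'M[R]_n -> 'M[R]_n) : Prop :=
  measurable_fun setT Pihat /\ forall Y, is_perm_mx (Pihat Y).

Definition signal (u : R) (v : 'I_n -> R) : 'M[R]_n :=
  \matrix_(i, j) phi n u (v i - v j).

End seriation.

(* Main.v *)
(* Cut [0, 1] into 4n bins of width 1/(4n). With probability of order n^-2 a
   given triple (a, b, c) forms an isolated path a - b - c of the graph
   {|V_i - V_j| <= 1/n}; there are thus linearly many such triples, and they are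
   disjoint. An ordering that does not place b between a and c puts two of the
   three pairs in an order that no Robinson matrix can follow, which costs u^2/2
   in squared Frobenius norm on entries that no other isolated triple uses.
   Exchanging the labels a and b preserves the law of V and, on this event,
   moves X by u in only four entries, hence moves the law of Y by at most 8u in
   total variation. As "b lies between a and c" and "a lies between b and c"
   exclude each other, a constant fraction of the isolated triples is misplaced
   in expectation. *)
From HB Require Import structures.
Require Import Defs.
From mathcomp Require Import all_boot all_order all_algebra perm.
From mathcomp Require Import all_classical all_reals all_analysis.
From mathcomp Require Import measurable_realfun.
From mathcomp Require Import ring lra zify.

Set Implicit Arguments.
Unset Strict Implicit.
Unset Printing Implicit Defensive.

Import Order.TTheory GRing.Theory Num.Theory.
Import numFieldNormedType.Exports.
Local Open Scope classical_set_scope.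
Local Open Scope ring_scope.

(** Transparent, so that its values unfold to the measure of a preimage. *)
Definition measurable_pushforward d1 d2 (T1 : measurableType d1)
    (T2 : measurableType d2) (R : realType) (mu : {measure set T1 -> \bar R})
    (f : T1 -> T2) (mf : measurable_fun setT f) :
  {measure set T2 -> \bar R}.
Proof. refine (pushforward mu f : {measure set T2 -> \bar R}); exact: mf. Defined.

(** * Gaussian shifts *)

Section gaussian_shift.
Context {R : realType}.
Implicit Types (h x : R) (A : set R).

Let shiftr h x := x + h.

Let measurable_shiftr h : measurable_fun [set: measurableTypeR R] (shiftr h).
Proof. by apply: measurable_funD. Qed.

Let shifted_lebesgue h : {measure set (measurableTypeR R) -> \bar R} :=
  @measurable_pushforward _ _ _ (measurableTypeR R) R (@lebesgue_measure R) _
    (measurable_shiftr h).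

(** The translated measure gives each half-open interval its length, which characterises Lebesgue
    measure. *)
Lemma lebesgue_measure_shift h (A : set (measurableTypeR R)) : measurable A ->
  lebesgue_measure ((fun x => x + h) @^-1` A) = lebesgue_measure A.
Proof.
move=> mA; apply/esym.
apply: (@lebesgue_measure_unique R (shifted_lebesgue h)) => // _ [[a b] _ <-].
rewrite /shifted_lebesgue /= /pushforward.
have -> : shiftr h @^-1` `]a, b] = `]a - h, b - h]%classic.
  by apply/seteqP; split => x; rewrite /= !in_itv/= /shiftr ltrBlDr lerBrDr.
rewrite !lebesgue_measure_itv/= !lte_fin ltrD2r; case: ifP => // _.
by rewrite -!EFinD; congr (_%:E); ring.
Qed.

Let measurable_EFin_normal_pdf (A : set R) (m s : R) :
  measurable_fun A (EFin \o normal_pdf m s).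
Proof.
apply/measurable_EFinP; apply: measurable_funTS; exact: measurable_normal_pdf.
Qed.

Let normal_pdfE1 m x :
  normal_pdf m 1 x = (Num.sqrt (pi *+ 2))^-1 * expR (- (x - m) ^+ 2 / 2).
Proof.
by rewrite normal_pdfE ?oner_neq0// /normal_peak /normal_fun expr1n mul1r.
Qed.

(** Translation invariance combined with [normal_pdf h 1 (x + h) = normal_pdf 0 1 x]. *)
Lemma normal_prob_shift h A : measurable A ->
  normal_prob 0 1 ((fun x => x + h) @^-1` A) = normal_prob h 1 A.
Proof.
move=> mA; rewrite /normal_prob.
transitivity (\int[shifted_lebesgue h]_(x in A) (normal_pdf h 1 x)%:E)%E; last first.
  apply: eq_measure_integral => B mB _.
  by rewrite /shifted_lebesgue /= /pushforward lebesgue_measure_shift.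
rewrite /shifted_lebesgue ge0_integral_pushforward//=.
- by apply: eq_integral => x _ /=; rewrite !normal_pdfE1 /shiftr addrK subr0.
- exact: measurable_shiftr.
- exact: measurable_EFin_normal_pdf.
- by move=> x _; rewrite lee_fin normal_pdf_ge0.
Qed.

(* 1 + y <= e^y gives the linear lower bound on p_h / p_0, and
   |x| <= 1 + x^2/4 <= e^(x^2/4) turns the first moment into an N(0, 2) mass. *)
Let normal_pdf_shift_le h x :
  normal_pdf 0 1 x <= normal_pdf h 1 x +
     (`|h| * Num.sqrt 2 * normal_pdf 0 (Num.sqrt 2) x + h ^+ 2 / 2 * normal_pdf 0 1 x).
Proof.
have s20 : Num.sqrt 2 != 0 :> R by rewrite gt_eqF// sqrtr_gt0.
rewrite !normal_pdfE1 normal_pdfE// /normal_peak /normal_fun subr0.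
rewrite sqr_sqrtr//.
set c := (Num.sqrt (pi *+ 2))^-1.
have c0 : 0 <= c by rewrite invr_ge0 sqrtr_ge0.
have -> : Num.sqrt (2 * pi *+ 2) = Num.sqrt 2 * Num.sqrt (pi *+ 2) :> R.
  by rewrite -mulrnAr sqrtrM.
rewrite invfM -/c.
have -> : `|h| * Num.sqrt 2 * ((Num.sqrt 2)^-1 * c * expR (- x ^+ 2 / (2 *+ 2))) =
  c * (`|h| * expR (- x ^+ 2 / 4)).
  rewrite (_ : 2 *+ 2 = 4); last by ring.
  by field.
have -> : h ^+ 2 / 2 * (c * expR (- x ^+ 2 / 2)) = c * (h ^+ 2 / 2 * expR (- x ^+ 2 / 2)) by ring.
rewrite -!mulrDr ler_wpM2l//.
set p := expR (- x ^+ 2 / 2).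
have -> : expR (- (x - h) ^+ 2 / 2) = p * expR (h * x - h ^+ 2 / 2).
  by rewrite -expRD; congr expR; field.
have -> : expR (- x ^+ 2 / 4) = p * expR (x ^+ 2 / 4).
  by rewrite -expRD; congr expR; field.
have p0 : 0 <= p by exact: expR_ge0.
have -> : p * expR (h * x - h ^+ 2 / 2) + (`|h| * (p * expR (x ^+ 2 / 4)) + h ^+ 2 / 2 * p) =
  p * (expR (h * x - h ^+ 2 / 2) + (`|h| * expR (x ^+ 2 / 4) + h ^+ 2 / 2)) by ring.
rewrite -[leLHS]mulr1 ler_wpM2l//.
have e1 := expR_ge1Dx (h * x - h ^+ 2 / 2).
have e2 := expR_ge1Dx (x ^+ 2 / 4).
have e3 : `|x| <= expR (x ^+ 2 / 4).
  apply: le_trans e2; have := sqr_ge0 (`|x| - 2); rewrite -(real_normK (num_real x)); nra.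
have e4 : - (h * x) <= `|h| * expR (x ^+ 2 / 4).
  by rewrite (le_trans (ler_norm _))// normrN normrM ler_wpM2l.
lra.
Qed.

(** The pointwise bound is integrated over [A], and its correction term over the whole line. That
    term has mass [|h| * sqrt 2 + h^2 / 2], at most [2 * |h|] because [sqrt 2 <= 3 / 2] and
    [|h| <= 1]. *)
Lemma normal_prob_le_shift h A : measurable A -> `|h| <= 1 ->
  (normal_prob 0 1 A <= normal_prob 0 1 ((fun x => x + h)%R @^-1` A) + (2 * `|h|)%:E)%E.
Proof.
move=> mA h1; rewrite normal_prob_shift//.
have mpdf := measurable_EFin_normal_pdf.
pose g x := (`|h| * Num.sqrt 2 * normal_pdf 0 (Num.sqrt 2) x + h ^+ 2 / 2 * normal_pdf 0 1 x)%R.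
have g0 x : (0 <= g x)%R.
  by apply: addr_ge0; apply: mulr_ge0; rewrite ?normal_pdf_ge0//;
    apply: mulr_ge0; rewrite ?sqr_ge0.
have mg D : measurable_fun D (fun x => (g x)%:E).
  apply/measurable_EFinP/measurable_funTS/measurable_funD; apply: measurable_funM => //;
  exact: measurable_normal_pdf.
apply: (@le_trans _ _ (\int[lebesgue_measure]_(x in A) ((normal_pdf h 1 x)%:E + (g x)%:E))%E).
  apply: ge0_le_integral => //.
  - by move=> x _; rewrite lee_fin normal_pdf_ge0.
  - exact: mpdf.
  - apply: emeasurable_funD; [exact: mpdf|exact: mg].
  - by move=> x _; rewrite -EFinD lee_fin normal_pdf_shift_le.
rewrite ge0_integralD//; last 4 first.
- by move=> x _; rewrite lee_fin normal_pdf_ge0.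
- exact: mpdf.
- by move=> x _; rewrite lee_fin.
- exact: mg.
rewrite leeD2l//.
apply: (@le_trans _ _ (\int[lebesgue_measure]_x (g x)%:E)%E).
  by apply: ge0_subset_integral => //; [exact: mg|move=> x _; rewrite lee_fin].
under eq_integral do rewrite EFinD EFinM [X in (_ + X)%E]EFinM.
rewrite ge0_integralD//; last 4 first.
- by move=> x _; rewrite -!EFinM lee_fin mulr_ge0 ?normal_pdf_ge0// mulr_ge0.
- by apply: measurable_funeM; exact: mpdf.
- by move=> x _; rewrite -EFinM lee_fin mulr_ge0 ?normal_pdf_ge0// mulr_ge0 ?sqr_ge0.
- by apply: measurable_funeM; exact: mpdf.
have Zpdf k t : (\int[lebesgue_measure]_x (k%:E * (normal_pdf 0 t x)%:E) =
    k%:E)%E.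
  rewrite integralZl//=; last exact: integrable_normal_pdf.
  by rewrite integral_normal_pdf mule1.
rewrite !Zpdf -EFinD lee_fin.
have s2 : Num.sqrt 2 <= 3 / 2 :> R.
  by rewrite -(ler_pXn2r (n:=2)) ?nnegrE ?sqrtr_ge0// ?sqr_sqrtr//; lra.
have := normr_ge0 h; rewrite -(real_normK (num_real h)); nra.
Qed.

End gaussian_shift.

(** * Laws of random matrices *)

Section matrix_measures.
Context {R : realType} {m n : nat}.
Implicit Types (A : 'I_m -> 'I_n -> set R) (S : set 'M[R]_(m, n)).

Lemma measurable_cylinder (i : 'I_m) (j : 'I_n) (B : set R) :
  measurable B -> measurable [set M : 'M[R]_(m, n) | B (M i j)].
Proof.
by move=> mB; apply: sub_sigma_algebra; exists i, j, B.
Qed.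

Lemma measurable_entry (D : set 'M[R]_(m, n)) (i : 'I_m) (j : 'I_n) :
  measurable_fun D (fun M : 'M[R]_(m, n) => M i j).
Proof.
by apply: measurable_funTS => _ B mB; rewrite setTI; exact: measurable_cylinder.
Qed.

Lemma measurable_fun_mx d (T : measurableType d) (f : T -> 'M[R]_(m, n)) :
  (forall i j, measurable_fun setT (fun x => f x i j)) ->
  measurable_fun setT f.
Proof.
move=> mf; apply: (measurability (@mx_cylinders R m n)) => //.
move=> _ [_ [i [j [B [mB ->]]]] <-].
exact: (mf i j measurableT B mB).
Qed.

Definition mx_box A : set 'M[R]_(m, n) := [set M | forall i j, A i j (M i j)].

Lemma mx_boxE A :
  mx_box A = \bigcap_(ij in [set: 'I_m * 'I_n])
    [set M : 'M[R]_(m, n) | A ij.1 ij.2 (M ij.1 ij.2)].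
Proof.
by apply/seteqP; split => M /= AM => [[i j] _|i j]; [exact: AM|exact: (AM (i, j))].
Qed.

Lemma measurable_mx_box A : (forall i j, measurable (A i j)) ->
  measurable (mx_box A).
Proof.
move=> mA; rewrite mx_boxE; apply: fin_bigcap_measurable => [|ij _]; first exact: finite_finset.
exact: measurable_cylinder.
Qed.

(** Boxes are stable under intersection and generate the sigma-algebra, so two measures that agree
    on them are equal. *)
Lemma mx_measure_unique (mu nu : {measure set 'M[R]_(m, n) -> \bar R}) :
  (mu setT < +oo)%E ->
  (forall A, (forall i j, measurable (A i j)) ->
    mu (mx_box A) = nu (mx_box A)) ->
  forall S, measurable S -> mu S = nu S.
Proof.
move=> muT eq_box S mS.
pose G := [set B | exists A, (forall i j, measurable (A i j)) /\ B = mx_box A].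
apply: (measure_unique G (fun _ => setT)) => //.
- apply/seteqP; split.
    apply: smallest_sub; first exact: smallest_sigma_algebra.
    move=> _ [i [j [B [mB ->]]]]; apply: sub_sigma_algebra.
    (* A cylinder is a box all of whose other sides are the full line. *)
    exists (fun i' j' => if (i' == i) && (j' == j) then B else setT); split.
      by move=> i' j'; case: ifP.
    apply/seteqP; split => [M BM i' j'|M /(_ i j)]; last by rewrite !eqxx.
    by case: ifP => // /andP[/eqP-> /eqP->].
  apply: smallest_sub; first exact: sigma_algebra_measurable.
  by move=> _ [A [mA ->]]; exact: measurable_mx_box.
- move=> _ _ [A [mA ->]] [B [mB ->]]; exists (fun i j => A i j `&` B i j); split.
    by move=> i j; exact: measurableI.
  apply/seteqP; split => [M [AM BM] i j|M ABM]; first by split.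
  by split => i j; have [] := ABM i j.
- by move=> _; exists (fun _ _ => setT); split => //; apply/seteqP; split.
- by apply/seteqP; split => // M _; exists 0%N.
- by move=> _ [A [mA ->]]; exact: eq_box.
Qed.

End matrix_measures.

(** * Gaussian matrices under deterministic shifts *)

Section gaussian_matrices.
Context {R : realType} {m n : nat}.
Variable nu : probability 'M[R]_(m, n) R.
Hypothesis nu_box : forall A : 'I_m -> 'I_n -> set R,
  (forall i j, measurable (A i j)) ->
  nu (mx_box A) = (\prod_(ij : 'I_m * 'I_n) normal_prob 0 1 (A ij.1 ij.2))%E.

Definition set_entry (i : 'I_m) (j : 'I_n) (Mx : 'M[R]_(m, n) * R) :
    'M[R]_(m, n) :=
  \matrix_(k, l) if (k, l) == (i, j) then Mx.2 else Mx.1 k l.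

Lemma measurable_set_entry i j : measurable_fun setT (set_entry i j).
Proof.
apply: measurable_fun_mx => k l.
under eq_fun do rewrite mxE.
case: ((k, l) == (i, j)); first exact: measurable_snd.
exact: (measurableT_comp (@measurable_entry _ _ _ setT k l) (@measurable_fst _ _ _ R)).
Qed.

(* Replacing one entry by an independent copy preserves the law, which reduces
   shifts of a matrix entry to the one-dimensional case by Fubini. *)
Lemma resample_entry i j S : measurable S ->
  (nu \x normal_prob 0 1)%E (set_entry i j @^-1` S) = nu S.
Proof.
pose eta := measurable_pushforward (nu \x normal_prob 0 1)%E (measurable_set_entry i j).
move=> mS; apply/esym.
have := @mx_measure_unique R m n nu eta.
apply => //; first by rewrite [ltLHS](probability_setT nu) ltry.
move=> A mA; rewrite [LHS](nu_box mA) /eta /= /pushforward.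
(* The old entry at [(i, j)] is overwritten, hence unconstrained: the preimage of the box is this
   relaxed box times [A i j]. *)
pose A' k l := if (k, l) == (i, j) then setT else A k l.
have -> : set_entry i j @^-1` mx_box A = mx_box A' `*` A i j.
  apply/seteqP; split => [[M x] AM|[M x] [/= AM Ax] k l].
    split => [k l|].
      by have := AM k l; rewrite /A' mxE/=; case: ifP.
    by have := AM i j; rewrite mxE eqxx.
  have := AM k l; rewrite /A' mxE/=; case: ifP => // /eqP[-> ->] //.
have mA' k l : measurable (A' k l) by rewrite /A'; case: ifP.
have -> := product_measure1E nu (normal_prob 0 1) (measurable_mx_box mA') (mA i j).
rewrite [X in (_ = X * _)%E](nu_box mA') (bigD1 (i, j))//= [in RHS](bigD1 (i, j))//= {1}/A' eqxx.
rewrite probability_setT mul1e muleC; congr (_ * _)%E.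
by apply: eq_bigr => -[k l] /negPf neq; rewrite /A' neq.
Qed.

Lemma measurable_addmx (D : 'M[R]_(m, n)) : measurable_fun setT (fun M : 'M[R]_(m, n) => M + D).
Proof.
apply: measurable_fun_mx => i j.
under eq_fun do rewrite mxE.
by apply: measurable_funD => //; exact: measurable_entry.
Qed.

Lemma measurable_preimage_addmx (D : 'M[R]_(m, n)) S : measurable S ->
  measurable [set M : 'M[R]_(m, n) | S (M + D)].
Proof.
by move=> mS; rewrite -[X in measurable X]setTI; exact: measurable_addmx.
Qed.

(** Total variation distance at most [eps] between the noise and its shift by [D]; passing to
    complements gives the reverse inequality. *)
Definition shift_bound (D : 'M[R]_(m, n)) (eps : R) :=
  forall S, measurable S -> (nu S <= nu [set M | S (M + D)%R] + eps%:E)%E.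

Lemma shift_boundD D1 D2 e1 e2 :
  shift_bound D1 e1 -> shift_bound D2 e2 -> shift_bound (D1 + D2) (e1 + e2).
Proof.
move=> b1 b2 S mS; apply: (le_trans (b2 _ mS)).
rewrite EFinD addeA leeD2r//.
have := b1 _ (measurable_preimage_addmx D2 mS).
by move=> /=; under [X in (_ <= nu X + _)%E]eq_set do rewrite -addrA.
Qed.

Lemma shift_bound_delta i j h : `|h| <= 1 ->
  shift_bound (h *: delta_mx i j) (2 * `|h|).
Proof.
move=> h1 S mS.
pose S' := [set M | S (M + h *: delta_mx i j)].
have mS' : measurable S' by exact: measurable_preimage_addmx.
rewrite -(resample_entry i j mS) -(resample_entry i j mS').
have mg S0 : measurable S0 -> measurable (set_entry i j @^-1` S0).
  by move=> mS0; rewrite -[X in measurable X]setTI; exact: measurable_set_entry.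
rewrite /product_measure1.
have mx S0 : measurable S0 -> measurable_fun setT
    (normal_prob 0 1 \o xsection (set_entry i j @^-1` S0)).
  by move=> mS0; apply: measurable_fun_xsection; exact: mg.
apply: (@le_trans _ _ (\int[nu]_M ((normal_prob 0 1 \o xsection (set_entry i j @^-1` S')) M +
   (2 * `|h|)%:E)))%E.
  apply: ge0_le_integral => //; first exact: mx.
    by apply: emeasurable_funD => //; exact: mx.
  move=> M _ /=.
  have mxM : measurable (xsection (set_entry i j @^-1` S) M).
    by apply: measurable_xsection; exact: mg.
  suff <- : (fun x => x + h) @^-1` xsection (set_entry i j @^-1` S) M =
      xsection (set_entry i j @^-1` S') M by exact: normal_prob_le_shift.
  apply/seteqP; split => x; rewrite /xsection/= !inE /S'/=; congr S;
    apply/matrixP => k l; rewrite !mxE/= xpair_eqE;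
    by case: ifP => kl; rewrite ?mulr1 ?mulr0 ?addr0.
rewrite ge0_integralD//; last exact: mx.
by rewrite leeD2l// integral_cst// [X in (_ * X)%E](probability_setT nu) mule1.
Qed.

End gaussian_matrices.

Definition mfun_of d1 d2 (T1 : measurableType d1) (T2 : measurableType d2)
    (f : T1 -> T2) (mf : measurable_fun setT f) : {mfun T1 >-> T2} :=
  HB.pack f (isMeasurableFun.Build _ _ _ _ f mf).

(** * Joint laws of independent variables *)

Section independent_entries.
Context d (T : measurableType d) (R : realType) (P : probability T R).

(** Independence fixes the joint law on rectangles, and these determine the product measure. *)
Lemma independent_joint_law d1 (T1 : measurableType d1) d2
    (T2 : measurableType d2) (X : {mfun T >-> T1}) (Y : {mfun T >-> T2}) :
  independent P X Y -> forall C, measurable C ->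
  P [set w | C (X w, Y w)] = (distribution P X \x distribution P Y)%E C.
Proof.
move=> indXY C mC.
have mXY : measurable_fun setT (fun w => (X w, Y w)) by exact: measurable_fun_pair.
pose J := measurable_pushforward P mXY.
apply/esym.
by apply: (@product_measure_unique _ _ _ _ _ (distribution P X) (distribution P Y) J).
Qed.

Lemma mutually_independent_all (I : finType) (X : I -> {RV P >-> R})
    (A : I -> set R) :
  mutually_independent P X -> (forall i, measurable (A i)) ->
  P [set w | forall i, A i (X i w)] = (\prod_i distribution P (X i) (A i))%E.
Proof.
move=> indX mA; have := indX [set: I]%SET A mA.
rewrite (eq_bigl xpredT) => [<-|i]; last by rewrite finset.in_setT.
congr (P _); apply/seteqP; split => w /= Aw i => [_|]; first exact: Aw.
by apply: Aw; exact: finset.in_setT.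
Qed.

Context {m n : nat} (W : 'I_m -> 'I_n -> {RV P >-> R}).

Lemma measurable_mx_of_entries :
  measurable_fun setT (fun w => \matrix_(i, j) W i j w).
Proof.
apply: measurable_fun_mx => i j; under eq_fun do rewrite mxE.
exact: measurable_funP.
Qed.

End independent_entries.

(** * Measure-preserving relabelling absorbed by the noise *)

Section exchange.
Context d1 (T1 : measurableType d1) (R : realType) (m n : nat).
Variables (mu : probability T1 R) (nu : probability 'M[R]_(m, n) R).
Variables (F : T1 -> 'M[R]_(m, n)) (s : T1 -> T1).
Hypothesis mF : measurable_fun setT F.
Hypothesis ms : measurable_fun setT s.
Hypothesis mu_s : forall B, measurable B -> mu (s @^-1` B) = mu B.

Let obs (G : set T1) (S : set 'M[R]_(m, n)) : set (T1 * 'M[R]_(m, n)) :=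
  [set ve | G ve.1 /\ S (F ve.1 + ve.2)].

Lemma measurable_signal_noise : measurable_fun setT
  (fun ve : T1 * 'M[R]_(m, n) => F ve.1 + ve.2).
Proof.
apply: measurable_fun_mx => i j; under eq_fun do rewrite mxE.
have mij := @measurable_entry R m n setT i j.
apply: measurable_funD.
  apply: (measurableT_comp (f := fun M : 'M[R]_(m, n) => M i j)) => //.
  exact: (measurableT_comp mF measurable_fst).
exact: (measurableT_comp mij measurable_snd).
Qed.

Lemma measurable_obs G S : measurable G -> measurable S ->
  measurable (obs G S).
Proof.
move=> mG mS; apply: measurableI.
  by rewrite -[X in measurable X]setTI; exact: measurable_fst.
by rewrite -[X in measurable X]setTI; exact: measurable_signal_noise.
Qed.

Let measurable_map_fst : measurable_fun setT
  (fun ve : T1 * 'M[R]_(m, n) => (s ve.1, ve.2)).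
Proof.
apply: measurable_fun_pair; last exact: measurable_snd.
exact: (measurableT_comp ms measurable_fst).
Qed.

Lemma product_measure_invariant C : measurable C ->
  (mu \x nu)%E [set ve | C (s ve.1, ve.2)] = (mu \x nu)%E C.
Proof.
move=> mC; apply/esym.
pose Q := measurable_pushforward (mu \x nu)%E measurable_map_fst.
suff /(_ C mC) -> : forall X, measurable X -> (mu \x nu)%E X = Q X by [].
apply: product_measure_unique.
move=> A B mA mB; rewrite /= /pushforward.
rewrite -(mu_s mA); apply: (product_measure1E mu nu) => //.
by rewrite -[X in measurable X]setTI; exact: ms.
Qed.

(** By invariance [v] may be replaced by [s v] in the event on the right. For each fixed [v] in [G]
    the two noise events then differ by the shift [D], which costs [eps]. Integrating over [v] gives
    the error [eps * mu G] instead of [eps], so it stays proportional to the probability of a rare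
    configuration. *)
Lemma exchange_le (G G' : set T1) (S : set 'M[R]_(m, n)) (D : 'M[R]_(m, n)) eps :
  measurable G -> measurable G' -> measurable S -> 0 <= eps ->
  (forall v, G' (s v) <-> G v) -> (forall v, G v -> F (s v) = F v + D) ->
  shift_bound nu D eps ->
  ((mu \x nu) (obs G S) <= (mu \x nu) (obs G' S) + eps%:E * mu G)%E.
Proof.
move=> mG mG' mS eps0 GG' FD bD.
rewrite -(product_measure_invariant (measurable_obs mG' mS)).
pose C := [set ve : T1 * 'M[R]_(m, n) | obs G' S (s ve.1, ve.2)].
rewrite -/C.
have mC : measurable C.
  rewrite -[X in measurable X]setTI.
  by apply: measurable_map_fst => //; exact: measurable_obs.
have mxs (B : set (T1 * 'M[R]_(m, n))) : measurable B ->
    measurable_fun setT (nu \o xsection B).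
  by move=> mB; apply: measurable_fun_xsection.
(* Writing [mu G] as the integral of an indicator reduces the claim to an inequality between
   sections at each [v]. *)
rewrite /product_measure1 -[in leRHS](setIT G) -integral_indic//.
have mG1 : measurable_fun setT (fun v => (\1_G v)%:E : \bar R).
  by apply/measurable_EFinP; exact: measurable_indic.
rewrite -ge0_integralZl//.
rewrite -ge0_integralD//; last 3 first.
- exact: mxs.
- by move=> v _; rewrite mule_ge0 ?lee_fin.
- exact: measurable_funeM.
apply: ge0_le_integral => //.
- exact: mxs (measurable_obs mG mS).
- by apply: emeasurable_funD; [exact: mxs|exact: measurable_funeM].
move=> v _ /=; rewrite indicE; case: (pselect (G v)) => Gv; last first.
  rewrite memNset//= mule0 adde0 (_ : xsection _ _ = set0) ?measure0//.
  by apply/seteqP; split => e //; rewrite /xsection/= inE => -[].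
rewrite mem_set//= mule1.
have -> : xsection (obs G S) v = [set e | S (e + F v)].
  apply/seteqP; split => e; rewrite /xsection/= inE /obs/= addrC; first by case.
  by split.
have -> : xsection C v = [set e | S (e + D + F v)].
  apply/seteqP; split => e; rewrite /xsection/= inE /C /obs/= FD//.
    by case=> _; rewrite [e + D + _]addrC [e + D]addrC addrA.
  by move=> Se; split; [exact/GG'|rewrite -addrA addrC [D + e]addrC].
exact: (bD _ (measurable_preimage_addmx (F v) mS)).
Qed.

End exchange.

(** * The loss of a misplaced triple *)

Section seriation_loss.
Context {R : realType} {n : nat}.
Implicit Types (X M : 'M[R]_n) (s : 'S_n).

Definition between (p : 'I_n -> 'I_n) (a b c : 'I_n) : bool :=
  (p a < p b < p c)%N || (p c < p b < p a)%N.

(** A triple has one middle item only, so an order that is right for the path a - b - c is wrong for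
    b - a - c. *)
Lemma between_excl p a b c : between p a b c -> ~~ between p b a c.
Proof. by rewrite /between => /orP[] /andP[]; lia. Qed.

Lemma mx_act_permE s X i j : mx_act (perm_mx s) X i j = X (s i) (s j).
Proof.
by rewrite /mx_act tr_perm_mx -col_permE -row_permE !mxE.
Qed.

(** Indexed by items, not positions: [s] sends a position to its item, so [M] is read through [s^-1]
    while [X] stays fixed. *)
Let residual s X M (x y : 'I_n) : R := X x y - M (s^-1 x)%g (s^-1 y)%g.

Lemma frobenius_permE s X M :
  frobenius (mx_act (perm_mx s) X - M) ^+ 2 =
  \sum_x \sum_y residual s X M x y ^+ 2.
Proof.
rewrite sqr_sqrtr; last by apply: sumr_ge0 => i _; apply: sumr_ge0 => j _; exact: sqr_ge0.
rewrite (reindex_inj (@perm_inj _ s^-1%g)); apply: eq_bigr => x _ /=.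
rewrite (reindex_inj (@perm_inj _ s^-1%g)); apply: eq_bigr => y _ /=.
by rewrite mxE [X in _ + X]mxE mx_act_permE !permKV.
Qed.

(** With [a] or [c] in the middle position, the Robinson property makes the entry [y] of [M] for the
    pair [a], [c] at least the entry [x] of one of the two pairs with signal [u]. Then [y^2 + (u -
    x)^2 >= (u + y - x)^2 / 2 >= u^2 / 2]. *)
Lemma robinson_violation (s : 'S_n) X M (u : R) a b c : robinson M -> 0 <= u ->
  a != b -> a != c -> b != c ->
  X a b = u -> X c b = u -> X a c = 0 -> ~~ between (s^-1)%g a b c ->
  u ^+ 2 / 2 <= residual s X M a c ^+ 2 + residual s X M a b ^+ 2 +
                residual s X M c b ^+ 2.
Proof.
move=> [Msym M1 M2] u0 ab ac bc Xab Xcb Xac; rewrite /residual Xab Xcb Xac.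
set p := (s^-1)%g => nb.
have symM i j : M i j = M j i by rewrite -{1}Msym mxE.
have neq x y : x != y -> (p x : nat) != p y.
  by move=> xy; apply: contra_neq xy => /val_inj/perm_inj.
have [] : M (p a) (p b) <= M (p a) (p c) \/ M (p c) (p b) <= M (p a) (p c).
- have := neq _ _ ab; have := neq _ _ ac; have := neq _ _ bc.
  move: nb; rewrite /between.
  case: (ltngtP (p a) (p c)) => // pac; case: (ltngtP (p b) (p c)) => // pbc;
  case: (ltngtP (p a) (p b)) => //= pab _ _ _ _;
  (by left; first [apply: M1; lia|apply: M2; lia]) ||
  (by right; rewrite (symM (p a)); first [apply: M1; lia|apply: M2; lia]).
- move: (M (p a) (p b)) (M (p a) (p c)) (M (p c) (p b)) => x y z xy.
  (* This product is [(u + y - x)^2 - u^2], and [2 * (y^2 + (u - x)^2) = (u + y - x)^2 + (u - x -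
     y)^2]. *)
  have : 0 <= (y - x) * (y - x + 2 * u) by apply: mulr_ge0; lra.
  have := sqr_ge0 (u - x - y); have := sqr_ge0 (u - z); nra.
- move: (M (p a) (p b)) (M (p a) (p c)) (M (p c) (p b)) => x y z xy.
  have : 0 <= (y - z) * (y - z + 2 * u) by apply: mulr_ge0; lra.
  have := sqr_ge0 (u - z - y); have := sqr_ge0 (u - x); nra.
Qed.

(** By injectivity each of the three families of pairs uses distinct entries, so its squared
    residuals sum to at most [f^2]; hence [u^2 / 2 * #|C| <= 3 * f^2]. Since [#|C| <= n],
    multiplying by [#|C|] gives a bound on [f] that is linear in [#|C|], ready for taking
    expectations. *)
Lemma frobenius_bad_triples (I : finType) (C : {set I}) (a b c : I -> 'I_n)
    (s : 'S_n) X M (u : R) :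
  robinson M -> 0 <= u ->
  {in C &, injective a} -> {in C &, injective c} ->
  (forall i, i \in C -> [/\ a i != b i, a i != c i & b i != c i]) ->
  (forall i, i \in C ->
    [/\ X (a i) (b i) = u, X (c i) (b i) = u & X (a i) (c i) = 0]) ->
  (forall i, i \in C -> ~~ between (s^-1)%g (a i) (b i) (c i)) ->
  u * #|C|%:R / (3 * Num.sqrt n%:R) <= frobenius (mx_act (perm_mx s) X - M).
Proof.
move=> rM u0 inja injc dist XC bad.
set r := residual s X M; set f := frobenius _.
have f0 : 0 <= f by exact: sqrtr_ge0.
have cardC : (#|C| <= n)%N.
  by rewrite -(card_in_imset inja) -[leqRHS]card_ord max_card.
have sumle (g : I -> 'I_n * 'I_n) : {in C &, injective g} ->
    \sum_(i in C) r (g i).1 (g i).2 ^+ 2 <= f ^+ 2.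
  move=> injg; rewrite frobenius_permE pair_big/=.
  rewrite -(big_imset (fun xy => r xy.1 xy.2 ^+ 2) injg)/=.
  rewrite big_mkcond; apply: ler_sum => xy _; case: ifP => // _; exact: sqr_ge0.
have key : u ^+ 2 / 2 * #|C|%:R <= 3 * f ^+ 2.
  apply: (@le_trans _ _ (\sum_(i in C) (r (a i) (c i) ^+ 2 + r (a i) (b i) ^+ 2 +
      r (c i) (b i) ^+ 2))).
    rewrite mulr_natr -sumr_const; apply: ler_sum => i iC.
    have [? ? ?] := dist _ iC; have [? ? ?] := XC _ iC.
    by apply: robinson_violation => //; exact: bad.
  rewrite !big_split/=.
  have h1 := sumle (fun i => (a i, c i)); have h2 := sumle (fun i => (a i, b i)).
  have h3 := sumle (fun i => (c i, b i)).
  have -> : 3 * f ^+ 2 = f ^+ 2 + f ^+ 2 + f ^+ 2 by ring.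
  apply: lerD; first apply: lerD.
  - by apply: h1 => i j iC jC [ij _]; exact: inja.
  - by apply: h2 => i j iC jC [ij _]; exact: inja.
  - by apply: h3 => i j iC jC [ij _]; exact: injc.
(* For [n = 0] the divisor is 0, and the convention [0^-1 = 0] makes the left side 0. *)
have [->|n0] := posnP n; first by rewrite sqrtr0 mulr0 invr0 mulr0.
have sn0 : 0 < Num.sqrt n%:R :> R by rewrite sqrtr_gt0 ltr0n.
rewrite ler_pdivrMr ?mulr_gt0//.
rewrite -(ler_pXn2r (n:=2)) ?nnegrE ?mulr_ge0// ?sqrtr_ge0//.
rewrite !exprMn (sqr_sqrtr (ler0n R n)).
have Cn : #|C|%:R <= n%:R :> R by rewrite ler_nat.
have C0 : 0 <= #|C|%:R :> R by [].
have u2 : 0 <= u ^+ 2 by exact: sqr_ge0.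
have f2 : 0 <= f ^+ 2 by exact: sqr_ge0.
move: key Cn C0 u2 f2.
move: (u ^+ 2) (f ^+ 2) (#|C|%:R : R) (n%:R : R) => x y w N key wN w0 x0 y0.
(* This yields the factor 6, which is relaxed to [9 = 3^2]. *)
have : x / 2 * w * w <= 3 * y * N by apply: ler_pM => //; rewrite mulr_ge0// mulr_ge0.
have : 0 <= y * N by rewrite mulr_ge0// (le_trans w0).
nra.
Qed.

Lemma robinson0 : robinson (0 : 'M[R]_n).
Proof. by split => [|i j k _ _|i j k _ _]; rewrite ?trmx0// !mxE. Qed.

(** A lower bound passes to [inf] only over a nonempty set; the zero matrix provides a member. *)
Lemma ell2_ge X Pi (x : R) :
  (forall M, robinson M -> x <= frobenius (mx_act Pi X - M)) -> x <= ell2 X Pi.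
Proof.
move=> xle; apply: lb_le_inf.
  by exists (frobenius (mx_act Pi X - 0)); exists 0 => //; exact: robinson0.
by move=> _ [M rM <-]; exact: xle.
Qed.

End seriation_loss.

(** * Isolated triples *)

Section planted_configurations.
Context {R : realType} {n : nat}.
Hypothesis n0 : (0 < n)%N.
Implicit Types (v : 'I_n -> R) (a b c x y : 'I_n).

Definition slot (i j : nat) : set R :=
  `[i%:R / (4 * n%:R), j%:R / (4 * n%:R)[%classic.

(* Consecutive points of a planted triple are two to four bins apart and its
   endpoints at least five, while 1/n is the width of four bins; everything else
   stays at least four bins away from the triple. *)
Definition planted_slot (k : nat) a b c x : set R :=
  if x == a then slot (k + 4) (k + 5)
  else if x == b then slot (k + 7) (k + 8)
  else if x == c then slot (k + 10) (k + 11)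
  else ~` slot k (k + 15).

(** A separate constraint on each coordinate, so that the probability factorises. *)
Definition planted k a b c v := forall x, planted_slot k a b c x (v x).

Definition distinct3 a b c := [&& a != b, a != c & b != c].

Let d : R := (4 * n%:R)^-1.

Let d_gt0 : 0 < d.
Proof. by rewrite invr_gt0 mulr_gt0// ltr0n. Qed.

Let ninvE : n%:R^-1 = 4 * d.
Proof. by rewrite /d invfM mulrA mulfV ?mul1r. Qed.

Let slotP i j (t : R) : slot i j t -> i%:R * d <= t /\ t < j%:R * d.
Proof. by rewrite /slot/= in_itv/= => /andP[]. Qed.

Let plantedP k a b c v : distinct3 a b c -> planted k a b c v ->
  [/\ slot (k + 4) (k + 5) (v a), slot (k + 7) (k + 8) (v b),
      slot (k + 10) (k + 11) (v c) &
      forall x, x != a -> x != b -> x != c ->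
        v x < k%:R * d \/ (k + 15)%:R * d <= v x].
Proof.
move=> /and3P[ab ac bc] pl.
have := pl a; have := pl b; have := pl c; rewrite /planted_slot.
rewrite !eqxx ![_ == a]eq_sym (negPf ab) (negPf ac) [_ == b]eq_sym (negPf bc).
move=> slc slb sla.
split=> // x xa xb xc; have := pl x.
rewrite /planted_slot (negPf xa) (negPf xb) (negPf xc) /slot/= in_itv/=.
case: (ltP (v x) (k%:R / (4 * n%:R))) => [|h1]; first by left.
by case: (ltP (v x) ((k + 15)%:R / (4 * n%:R))) => [//|]; right.
Qed.

(** A shared [a] or [c] reveals its bin and hence [k]. In the common window only the items of the
    second triple may occur, and their bins tell them apart. This provides the injectivity demanded
    by [frobenius_bad_triples]. *)
Lemma planted_uniq k k' a b c a' b' c' v :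
  distinct3 a b c -> distinct3 a' b' c' ->
  planted k a b c v -> planted k' a' b' c' v ->
  a = a' \/ c = c' -> [/\ k = k', a = a', b = b' & c = c'].
Proof.
move=> abc abc' pl pl' eqac.
have [/slotP[a1 a2] /slotP[b1 b2] /slotP[c1 c2] _] := plantedP abc pl.
have [/slotP[a1' a2'] /slotP[b1' b2'] /slotP[c1' c2'] out'] := plantedP abc' pl'.
rewrite !natrD in a1 a2 b1 b2 c1 c2 a1' a2' b1' b2' c1' c2' out'.
have kk' : k = k'.
  have kd i j : i%:R * d < (j%:R + 1) * d -> (i <= j)%N.
    by rewrite ltr_pM2r// natr1 ltr_nat ltnS.
  by apply/eqP; rewrite eqn_leq; apply/andP; split; apply: kd;
    case: eqac => e; rewrite -e in a1' a2' c1' c2'; lra.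
rewrite -kk' in a1' a2' b1' b2' c1' c2' out'.
have dpos := d_gt0.
have neq x y : v x <> v y -> x != y by apply: contra_not_neq => ->.
split => //; apply/eqP; apply/negPn/negP => ne.
- have [] := out' a => //; first [by apply: neq; lra|lra].
- have [] := out' b => //; first [by apply: neq; lra|lra].
- have [] := out' c => //; first [by apply: neq; lra|lra].
Qed.

Lemma phiE (u t : R) : phi n u t = if `|t| <= 4 * d then u else 0.
Proof.
rewrite /phi indicE -ninvE; case: ifPn => tn; first by rewrite mem_set ?mulr1.
by rewrite memNset ?mulr0//=; exact/negP.
Qed.

Lemma signalE u v x y : signal u v x y = phi n u (v x - v y).
Proof. by rewrite mxE. Qed.

Lemma signal_sym u v x y : signal u v x y = signal u v y x.
Proof. by rewrite !signalE !phiE distrC. Qed.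

Let signal_near u v x y : `|v x - v y| <= 4 * d -> signal u v x y = u.
Proof. by rewrite signalE phiE => ->. Qed.

Let signal_far u v x y : 4 * d < `|v x - v y| -> signal u v x y = 0.
Proof. by rewrite signalE phiE leNgt => ->. Qed.

Lemma signal_diag u v x : signal u v x x = u.
Proof. by apply: signal_near; rewrite subrr normr0 mulr_ge0// ltW. Qed.

Lemma planted_signal k a b c u v : distinct3 a b c -> planted k a b c v ->
  [/\ signal u v a b = u, signal u v b c = u, signal u v a c = 0 &
      forall x, x != a -> x != b -> x != c ->
      [/\ signal u v a x = 0, signal u v b x = 0 & signal u v c x = 0]].
Proof.
move=> abc pl.
have [/slotP[a1 a2] /slotP[b1 b2] /slotP[c1 c2] out] := plantedP abc pl.
rewrite !natrD in a1 a2 b1 b2 c1 c2 out.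
have dpos := d_gt0.
split.
- by apply: signal_near; rewrite ler_norml; apply/andP; split; lra.
- by apply: signal_near; rewrite ler_norml; apply/andP; split; lra.
- by apply: signal_far; rewrite ltr_normr; apply/orP; right; lra.
- move=> x xa xb xc; have ox := out x xa xb xc.
  split; apply: signal_far; rewrite ltr_normr; apply/orP;
  by case: ox => ?; [left|right]; lra.
Qed.

(** The exchange turns the path a - b - c into b - a - c: the edge between [b] and [c] is lost and
    one between [a] and [c] appears. Isolation keeps every other entry unchanged. *)
Lemma signal_swap k a b c u v : distinct3 a b c -> planted k a b c v ->
  signal u (v \o tperm a b) = signal u v +
    (u *: delta_mx a c + u *: delta_mx c a +
     ((- u) *: delta_mx b c + (- u) *: delta_mx c b)).
Proof.
move=> abc pl; have [Xab Xbc Xac Xout] := planted_signal u abc pl.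
have /and3P[ab ac bc] := abc.
have Xs := signal_sym u v; have Xd := signal_diag u v.
have [Xba Xcb Xca] : [/\ signal u v b a = u, signal u v c b = u & signal u v c a = 0].
  by split; rewrite Xs.
have [ba ca cb] : [/\ b != a, c != a & c != b] by split; rewrite eq_sym.
have cases x : x = a \/ x = b \/ x = c \/ [/\ x != a, x != b & x != c].
  have [->|xa] := eqVneq x a; first by left.
  have [->|xb] := eqVneq x b; first by right; left.
  have [->|xc] := eqVneq x c; first by right; right; left.
  by right; right; right.
apply/matrixP => x y.
rewrite [LHS]signalE [v \o _]/comp -signalE [RHS]mxE.
set D := (X in _ = _ + X x y).
have -> : D x y = u * ((x == a) && (y == c))%:R + u * ((x == c) && (y == a))%:R +
  (- u * ((x == b) && (y == c))%:R + - u * ((x == c) && (y == b))%:R).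
  by rewrite /D !mxE.
case: (cases x) => [->|[->|[->|[xa xb xc]]]]; case: (cases y) => [->|[->|[->|[ya yb yc]]]];
  rewrite ?tpermL ?tpermR ?[tperm a b c]tpermD// ?[tperm a b x]tpermD 1?eq_sym// ?[tperm a b y]tpermD 1?eq_sym//.
all: rewrite ?eqxx ?(negPf ab) ?(negPf ac) ?(negPf bc) ?(negPf ba) ?(negPf ca) ?(negPf cb)
   ?(negPf xa) ?(negPf xb) ?(negPf xc) ?(negPf ya) ?(negPf yb) ?(negPf yc) ?andbF/=.
all: rewrite ?Xd ?Xab ?Xbc ?Xac ?Xba ?Xca ?Xcb.
all: try (have [xa0 xb0 xc0] := Xout x xa xb xc; rewrite ?(Xs x a) ?(Xs x b) ?(Xs x c) ?xa0 ?xb0 ?xc0).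
all: try (have [ya0 yb0 yc0] := Xout y ya yb yc; rewrite ?ya0 ?yb0 ?yc0).
all: ring.
Qed.

End planted_configurations.

(** * Probability of a planted configuration *)

Section planted_probability.
Context {R : realType} {n : nat}.

Lemma uniform_prob_itvco (x y : R) : 0 <= x -> x <= y -> y <= 1 ->
  uniform_prob (@ltr01 R) `[x, y[%classic = (y - x)%:E.
Proof.
move=> x0 xy y1; rewrite /uniform_prob.
rewrite (eq_integral (cst 1%E)); last first.
  move=> t /set_mem; rewrite /= in_itv/= /uniform_pdf => /andP[xt ty].
  by rewrite (le_trans x0 xt) (le_trans (ltW ty) y1) subr0 invr1.
rewrite integral_cst//= mul1e lebesgue_measure_itv/= lte_fin.
case: ltP => // yx; have -> : x = y by apply/eqP; rewrite eq_le xy yx.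
by rewrite subrr.
Qed.

Hypothesis n15 : (15 <= n)%N.
Let n0 : (0 < n)%N. Proof. exact: leq_trans n15. Qed.
Let d : R := (4 * n%:R)^-1.

Let d_gt0 : 0 < d.
Proof. by rewrite invr_gt0 mulr_gt0// ltr0n. Qed.

Lemma uniform_prob_slot (i j : nat) : (i <= j)%N -> (j <= 4 * n)%N ->
  uniform_prob (@ltr01 R) (@slot R n i j) = ((j - i)%:R * d)%:E.
Proof.
move=> ij jn; rewrite uniform_prob_itvco.
- by rewrite natrB// mulrBl.
- by rewrite mulr_ge0// ltW.
- by rewrite ler_wpM2r ?ler_nat// ltW.
- by rewrite ler_pdivrMr ?mulr_gt0 ?ltr0n// mul1r -natrM ler_nat.
Qed.

Lemma measurable_slot i j : measurable (@slot R n i j).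
Proof. exact: measurable_itv. Qed.

Lemma measurable_planted_slot k (a b c x : 'I_n) :
  measurable (planted_slot k a b c x : set R).
Proof.
rewrite /planted_slot; do 3 (case: ifP => _; first exact: measurable_slot).
by apply: measurableC; exact: measurable_slot.
Qed.

Let dn : 15 * d * n%:R = 15 / 4.
Proof. by rewrite /d; field; rewrite pnatr_eq0 -lt0n. Qed.

Let d_small : 15 * d <= 1 / 4.
Proof.
have : 15 * d * 15 <= 15 * d * n%:R by rewrite ler_pM2l ?ler_nat// mulr_gt0.
by rewrite dn; lra.
Qed.

(** With [q = 15 * d], [(1 - q)^-1 = 1 + q / (1 - q) <= expR (q / (1 - q))]. In the [n]-th power the
    exponent is [n * q / (1 - q)], at most [(15 / 4) / (3 / 4) = 5]. *)
Let expR5_le : expR (- 5) <= (1 - 15 * d) ^+ n.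
Proof.
have q0 : 0 < 1 - 15 * d by have := d_small; lra.
rewrite expRN -[leRHS]invrK lef_pV2 ?posrE ?expR_gt0 ?invr_gt0 ?exprn_gt0//.
have qV : (1 - 15 * d)^-1 <= expR (15 * d / (1 - 15 * d)).
  apply: le_trans (expR_ge1Dx _).
  by rewrite le_eqVlt; apply/orP; left; apply/eqP; field; rewrite gt_eqF.
rewrite -exprVn (le_trans (y := expR (15 * d / (1 - 15 * d)) ^+ n))//.
  by rewrite lerXn2r// nnegrE ?invr_ge0 ?expR_ge0// ltW.
rewrite -expRM_natl ler_expR mulrA ler_pdivrMr// mulrC dn.
have := d_small; lra.
Qed.

Lemma planted_prob_ge k (a b c : 'I_n) : (k + 15 <= 4 * n)%N -> distinct3 a b c ->
  ((expR (- 5) * d ^+ 3)%:E <=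
   \prod_(x < n) uniform_prob (@ltr01 R) (planted_slot k a b c x))%E.
Proof.
move=> kn /and3P[ab ac bc].
pose q x : R := if x == a then d else if x == b then d else if x == c then d
  else 1 - 15 * d.
have slot1 i j : j = i.+1 -> (j <= 4 * n)%N -> uniform_prob (@ltr01 R) (@slot R n i j) = d%:E.
  by move=> -> i4n; rewrite uniform_prob_slot// subSnn mul1r.
have -> : (\prod_(x < n) uniform_prob (@ltr01 R) (planted_slot k a b c x) =
    (\prod_(x < n) q x)%:E)%E.
  rewrite -prodEFin; apply: eq_bigr => x _; rewrite /planted_slot /q.
  do 3 (case: ifP => _; first by rewrite slot1//; lia).
  transitivity (1 - uniform_prob (@ltr01 R) (@slot R n k (k + 15)))%E.
    by apply: probability_setC; exact: measurable_slot.
  by rewrite uniform_prob_slot ?leq_addr// addKn.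
have q0 : 0 <= 1 - 15 * d by have := d_small; lra.
rewrite lee_fin (bigD1 a)//= (bigD1 b) 1?eq_sym//= (bigD1 c)/=; last first.
  by rewrite ![c == _]eq_sym ac bc.
rewrite {1 2 3}/q eqxx [b == a]eq_sym (negPf ab) eqxx ![c == _]eq_sym (negPf ac) (negPf bc) eqxx.
rewrite (_ : expR _ * _ = d * (d * (d * expR (- 5)))); last by ring.
rewrite !ler_pM2l//.
apply: (le_trans expR5_le).
rewrite (eq_bigr (fun _ => 1 - 15 * d)); last first.
  by move=> x /andP[/andP[xa xb] xc]; rewrite /q (negPf xa) (negPf xb) (negPf xc).
(* There are at most [n] remaining factors, each at most 1, so the full [n]-th power is a lower
   bound. *)
rewrite prodr_const ler_wiXn2l//; first by rewrite gerBl mulr_ge0// ltW.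
by rewrite -[leqRHS]card_ord max_card.
Qed.

End planted_probability.

(** * The lower bound *)

(* Unlike [ge0_le_integral], no measurability is needed. *)
Lemma ge0_le_integralT d (T : measurableType d) (R : realType)
    (mu : {measure set T -> \bar R}) (f g : T -> \bar R) :
  (forall x, 0 <= f x)%E -> (forall x, f x <= g x)%E ->
  (\int[mu]_x f x <= \int[mu]_x g x)%E.
Proof.
move=> f0 fg; have g0 x : (0 <= g x)%E by exact: le_trans (fg x).
rewrite !ge0_integralTE//; apply: ereal_sup_le => _ [h hf <-].
by exists h => // x; exact: le_trans (fg x).
Qed.

Lemma card_distinct3 n :
  (n * (n.-1 * n.-2) <=
   #|[pred i : 'I_n * ('I_n * 'I_n) | distinct3 i.1 i.2.1 i.2.2]|)%N.
Proof.
rewrite -sum1_card.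
rewrite -(pair_big_dep xpredT (fun a (bc : 'I_n * 'I_n) => distinct3 a bc.1 bc.2)
  (fun _ _ => 1%N))/=.
rewrite -[X in (X * _ <= _)%N]card_ord -sum_nat_const; apply: leq_sum => a _.
rewrite -(pair_big_dep (fun b => a != b)
  (fun b c => (a != c) && (b != c)) (fun _ _ => 1%N))/=.
have n1E : n.-1 = #|[pred b | a != b]|.
  rewrite -[X in X.-1 = _]card_ord -(cardC1 a).
  by apply: eq_card => b; rewrite !inE eq_sym.
rewrite [X in (X * _ <= _)%N]n1E -sum_nat_const; apply: leq_sum => b; rewrite inE => ab.
rewrite sum1_card.
have -> : n.-2 = #|~: [set a; b]|%SET.
  by rewrite cardsCs finset.setCK cards2 ab card_ord subn2.
apply: subset_leq_card; apply/fintype.subsetP => c.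
by rewrite !inE negb_or ![c == _]eq_sym.
Qed.

Section random_seriation.
Context {R : realType} {n : nat}.
Hypothesis n15 : (15 <= n)%N.
Context d (T : measurableType d) (P : probability T R).
Variables (V : 'I_n -> {RV P >-> R}) (E : 'I_n -> 'I_n -> {RV P >-> R}).
Hypothesis indV : mutually_independent P V.
Hypothesis unifV : forall i (A : set R), measurable A ->
  distribution P (V i) A = uniform_prob (@ltr01 R) A.
Hypothesis indE : mutually_independent P (fun ij : 'I_n * 'I_n => E ij.1 ij.2).
Hypothesis gaussE : forall i j (A : set R), measurable A ->
  distribution P (E i j) A = normal_prob 0 1 A.
Let n0 : (0 < n)%N. Proof. exact: leq_trans n15. Qed.

(** * Laws of the latent positions and of the noise *)

Let Vrow w : 'rV[R]_n := \row_i V i w.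
Let Emx w : 'M[R]_n := \matrix_(i, j) E i j w.
Hypothesis indVE : independent P Vrow Emx.
Variable u : R.
Hypotheses (u0 : 0 < u) (u16 : u <= 1 / 16).

Let X w : 'M[R]_n := signal u (fun i => V i w).
Let Y w := X w + Emx w.
Let dlt : R := (4 * n%:R)^-1.

Let measurable_Vrow : measurable_fun setT Vrow.
Proof. exact: (measurable_mx_of_entries (fun _ : 'I_1 => V)). Qed.

Let measurable_Emx : measurable_fun setT Emx.
Proof. exact: (measurable_mx_of_entries E). Qed.

Let muV : probability 'rV[R]_n R := distribution P (mfun_of measurable_Vrow).
Let nu : probability 'M[R]_n R := distribution P (mfun_of measurable_Emx).

Let nu_box (A : 'I_n -> 'I_n -> set R) : (forall i j, measurable (A i j)) ->
  nu (mx_box A) = (\prod_(ij : 'I_n * 'I_n) normal_prob 0 1 (A ij.1 ij.2))%E.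
Proof.
move=> mA.
have := mutually_independent_all indE (fun ij => mA ij.1 ij.2).
under eq_bigr do rewrite gaussE//.
move=> <-; rewrite /nu /= /distribution /pushforward; congr (P _).
apply/seteqP; split => w /= Aw => [[i j]|i j]; first by have := Aw i j; rewrite mxE.
by rewrite mxE; exact: (Aw (i, j)).
Qed.

Let V_box (A : 'I_n -> set R) : (forall i, measurable (A i)) ->
  P [set w | forall i, A i (V i w)] = (\prod_i uniform_prob (@ltr01 R) (A i))%E.
Proof.
move=> mA; rewrite mutually_independent_all//.
by under eq_bigr do rewrite unifV//.
Qed.

Let muV_box (A : 'I_1 -> 'I_n -> set R) : (forall i j, measurable (A i j)) ->
  muV (mx_box A) = (\prod_i uniform_prob (@ltr01 R) (A ord0 i))%E.
Proof.
move=> mA; rewrite -(V_box (mA ord0)) /muV /= /distribution /pushforward; congr (P _).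
apply/seteqP; split => w /= Aw => [i|i j]; first by have := Aw ord0 i; rewrite mxE.
by rewrite mxE (ord1 i); exact: Aw.
Qed.

Let measurable_col_perm (s : 'S_n) :
  measurable_fun setT (col_perm s : 'rV[R]_n -> 'rV[R]_n).
Proof.
apply: measurable_fun_mx => i j; under eq_fun do rewrite mxE.
exact: measurable_entry.
Qed.

(** Exchangeability: on boxes, permuting identically distributed independent coordinates only
    reorders the factors of a product. *)
Let muV_col_perm (s : 'S_n) B : measurable B ->
  muV ((col_perm s : 'rV[R]_n -> 'rV[R]_n) @^-1` B) = muV B.
Proof.
move=> mB; apply/esym.
suff /(_ B mB) -> : forall B, measurable B ->
  muV B = measurable_pushforward muV (@measurable_col_perm s) B by [].
apply: mx_measure_unique; first by rewrite [ltLHS](probability_setT muV) ltry.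
move=> A mA; rewrite [LHS](muV_box mA) /= /pushforward.
have -> : (col_perm s : 'rV[R]_n -> 'rV[R]_n) @^-1` mx_box A =
    mx_box (fun i j => A i ((s^-1)%g j)).
  apply/seteqP; split => v Av i j.
    by have := Av i ((s^-1)%g j); rewrite mxE permKV.
  by rewrite mxE; have := Av i (s j); rewrite permK.
rewrite [RHS]muV_box//.
exact: (reindex_inj (@perm_inj _ (s^-1)%g)).
Qed.

(** Four single-entry shifts of size [u], at a cost of [2 * u] each. *)
Let shift_bound_swap (a b c : 'I_n) :
  shift_bound nu (u *: delta_mx a c + u *: delta_mx c a +
    ((- u) *: delta_mx b c + (- u) *: delta_mx c b)) (8 * u).
Proof.
have u1 : `|u| <= 1.
  by rewrite gtr0_norm//; apply: le_trans u16 _; lra.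
have b1 i j : shift_bound nu (u *: delta_mx i j) (2 * u).
  by rewrite -{2}(gtr0_norm u0); exact: shift_bound_delta.
have b2 i j : shift_bound nu (- u *: delta_mx i j) (2 * u).
  by rewrite -{2}(gtr0_norm u0) -normrN; apply: shift_bound_delta; rewrite ?normrN.
have -> : 8 * u = 2 * u + 2 * u + (2 * u + 2 * u) by ring.
by apply: shift_boundD; apply: shift_boundD.
Qed.

Let F (v : 'rV[R]_n) : 'M[R]_n := signal u (v ord0).

Let measurable_F : measurable_fun setT F.
Proof.
apply: measurable_fun_mx => i j.
rewrite (_ : (fun v => F v i j) = fun v : 'rV[R]_n =>
   if `|v ord0 i - v ord0 j| <= 4 * (4 * n%:R)^-1 then u else 0); last first.
  by apply/funext => v; rewrite signalE phiE.
apply: measurable_fun_ifT => //.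
apply: measurable_fun_ler => //; apply: measurableT_comp => //.
by apply: measurable_funB; exact: measurable_entry.
Qed.

Let planted_set k (a b c : 'I_n) : set 'rV[R]_n :=
  mx_box (fun _ => planted_slot k a b c).

Let planted_setE k a b c v : planted_set k a b c v <-> planted k a b c (v ord0).
Proof.
split => [plv x|plv i x]; first exact: plv.
by rewrite (ord1 i); exact: plv.
Qed.

Let measurable_planted_set k a b c : measurable (planted_set k a b c).
Proof. by apply: measurable_mx_box => _ x; exact: measurable_planted_slot. Qed.

Let planted_swap k (a b c : 'I_n) (v : 'rV[R]_n) : distinct3 a b c ->
  planted_set k b a c (col_perm (tperm a b) v) <-> planted_set k a b c v.
Proof.
move=> /and3P[ab ac bc].
have slotE x : planted_slot k b a c (tperm a b x) = planted_slot k a b c x :> set R.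
  rewrite /planted_slot; case: tpermP => [->|->|/eqP xa /eqP xb].
  - by rewrite !eqxx.
  - by rewrite (negPf ab) !eqxx [b == a]eq_sym (negPf ab).
  - by rewrite (negPf xa) (negPf xb).
split => [pl i x|pl i x].
  by have := pl i (tperm a b x); rewrite mxE tpermK slotE.
by have := pl i (tperm a b x); rewrite -slotE tpermK mxE.
Qed.

Let obs k a b c (S : set 'M[R]_n) : set T :=
  [set w | planted k a b c (fun i => V i w) /\ S (Y w)].

Let Vrow0 w : (Vrow w ord0 : 'I_n -> R) = (fun i => V i w).
Proof. by apply/funext => i; rewrite mxE. Qed.

Let F_Vrow w : F (Vrow w) = X w.
Proof. by rewrite /F Vrow0. Qed.

Let obs_joint k a b c S : obs k a b c S =
  [set w | [set ve : 'rV[R]_n * 'M[R]_n |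
     planted_set k a b c ve.1 /\ S (F ve.1 + ve.2)] (Vrow w, Emx w)].
Proof.
apply/seteqP; split => w [/= pl SY]; split; rewrite /= ?F_Vrow//.
- by apply/planted_setE; rewrite Vrow0.
- by move/planted_setE: pl; rewrite Vrow0.
- by rewrite F_Vrow in SY.
Qed.

Let measurable_Y : measurable_fun setT Y.
Proof.
have mVE : measurable_fun setT (fun w => (Vrow w, Emx w)).
  exact: measurable_fun_pair.
rewrite (_ : Y = (fun ve => F ve.1 + ve.2) \o (fun w => (Vrow w, Emx w))).
  by apply: measurableT_comp mVE; exact: measurable_signal_noise.
by apply/funext => w; rewrite /= F_Vrow.
Qed.

Let measurable_obsP k a b c S : measurable S -> measurable (obs k a b c S).
Proof.
move=> mS; have -> : obs k a b c S = Vrow @^-1` planted_set k a b c `&` Y @^-1` S.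
  apply/seteqP; split => w [/= pl SY]; split => //.
    by apply/planted_setE; rewrite Vrow0.
  by move/planted_setE: pl; rewrite Vrow0.
apply: measurableI; rewrite -[X in measurable X]setTI.
  exact: (measurable_Vrow measurableT (measurable_planted_set k a b c)).
exact: measurable_Y.
Qed.

(** Label exchange along [tperm a b]. The event [S] concerns the observation alone, so it is the
    same on both sides while the planted path changes. *)
Let obs_swap k a b c S : distinct3 a b c -> measurable S ->
  (P (obs k a b c S) <= P (obs k b a c S) + (8 * u)%:E * P (obs k a b c setT))%E.
Proof.
move=> abc mS.
have joint C : measurable C -> P [set w | C (Vrow w, Emx w)] = (muV \x nu)%E C.
  exact: (@independent_joint_law _ _ _ P _ _ _ _ (mfun_of measurable_Vrow)
    (mfun_of measurable_Emx) indVE).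
have -> : P (obs k a b c setT) = muV (planted_set k a b c).
  rewrite /muV /= /distribution /pushforward; congr (P _).
  apply/seteqP; split => w /=; first by case=> pl _; apply/planted_setE; rewrite Vrow0.
  by move/planted_setE; rewrite Vrow0.
rewrite !obs_joint !joint; [|exact: measurable_obs..].
apply: (@exchange_le _ _ _ _ _ muV nu F (col_perm (tperm a b)) measurable_F
  (@measurable_col_perm _) (@muV_col_perm _) _ _ _
  (u *: delta_mx a c + u *: delta_mx c a +
    ((- u) *: delta_mx b c + (- u) *: delta_mx c b))) => //.
- by rewrite mulr_ge0// ltW.
- by move=> v; exact: planted_swap.
- move=> v /planted_setE pl; rewrite /F -(signal_swap n0 u abc pl).
  by congr signal; apply/funext => x; rewrite mxE.
Qed.

(** * Triples misplaced by an estimator *)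

Variable Pihat : 'M[R]_n -> 'M[R]_n.
Hypothesis estPihat : estimator Pihat.

(* Item [s i] sits at position [i], so that positions are given by [s^-1]. *)
Let ord_of (M : 'M[R]_n) : 'S_n := odflt 1%g [pick s | M == perm_mx s].

Let ord_ofK M : is_perm_mx M -> perm_mx (ord_of M) = M.
Proof.
case/is_perm_mxP => s Ms; rewrite /ord_of; case: pickP => [s' /eqP//|/(_ s)].
by rewrite Ms eqxx.
Qed.

Let order y := ord_of (Pihat y).

(** A finite union of preimages of single permutation matrices, each of which is a box with
    singleton sides. *)
Let measurable_order (Q : pred 'S_n) : measurable [set y | Q (order y)].
Proof.
have -> : [set y | Q (order y)] =
    \bigcup_(s in [set s | Q (ord_of (perm_mx s))]) (Pihat @^-1` [set perm_mx s]).
  apply/seteqP; split => y /= => [Qy|[s Qs ys]]; last by rewrite /order ys.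
  by exists (order y); rewrite /order/= ord_ofK//; exact: estPihat.2.
apply: fin_bigcup_measurable => [|s _]; first exact: finite_finset.
rewrite -[X in measurable X]setTI; apply: estPihat.1 => //.
rewrite (_ : [set _] = mx_box (fun i j => [set perm_mx s i j])).
  by apply: measurable_mx_box => i j; exact: measurable_set1.
by apply/seteqP; split => M /= => [->//|Ms]; apply/matrixP => i j; exact: Ms.
Qed.

Let btw a b c : set 'M[R]_n := [set y | between ((order y)^-1)%g a b c].

Let measurable_btw a b c : measurable (btw a b c).
Proof. exact: (measurable_order (fun s => between (s^-1)%g a b c)). Qed.

Let bad k a b c : set T := obs k a b c (~` btw a b c).

Let measurable_bad k a b c : measurable (bad k a b c).
Proof. by apply: measurable_obsP; exact: measurableC. Qed.

Let obs_prob_ge k a b c : (k + 15 <= 4 * n)%N -> distinct3 a b c ->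
  ((expR (- 5) * dlt ^+ 3)%:E <= P (obs k a b c setT))%E.
Proof.
move=> kn abc; apply: (le_trans (planted_prob_ge n15 kn abc)).
rewrite -V_box; last by move=> x; exact: measurable_planted_slot.
by rewrite le_eqVlt; apply/orP; left; apply/eqP; congr (P _); apply/seteqP;
  split => w // [].
Qed.

(** Let [p] be the probability that a - b - c is planted. Either it is misplaced, or [b] is put in
    the middle; up to [8 * u * p], the latter is no more likely than [b] in the middle when b - a -
    c is planted, where it is an error. So [p] is at most the two error probabilities plus
    [8 * u * p]. *)
Let bad_pair_ge k a b c : (k + 15 <= 4 * n)%N -> distinct3 a b c ->
  expR (- 5) * dlt ^+ 3 / 2 <= fine (P (bad k a b c)) + fine (P (bad k b a c)).
Proof.
move=> kn abc.
have h1 := obs_prob_ge kn abc.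
have h2 := obs_swap k abc (measurable_btw a b c).
have h3 : (P (obs k b a c (btw a b c)) <= P (bad k b a c))%E.
  apply: le_measure; rewrite ?inE; [exact: measurable_obsP|exact: measurable_bad|].
  move=> w [pl bw]; split => //; exact/negP/between_excl.
have h4 : P (obs k a b c setT) = (P (bad k a b c) + P (obs k a b c (btw a b c)))%E.
  rewrite -measureU; [|exact: measurable_bad|exact: measurable_obsP|].
    congr (P _); apply/seteqP; split => w; last by case=> -[].
    by case=> pl _; have [bw|bw] := pselect (btw a b c (Y w)); [right|left].
  by apply/seteqP; split => w // [[_ nb] [_ b']].
move: h1 h2 h3 h4.
have finP A : measurable A -> exists2 p : R, P A = p%:E & 0 <= p.
  by move=> mA; exists (fine (P A)); rewrite ?fineK ?fin_num_measure ?fine_ge0.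
have [p -> p0] := finP _ (measurable_obsP k a b c measurableT).
have [q -> _] := finP _ (measurable_bad k a b c).
have [r -> _] := finP _ (measurable_bad k b a c).
have [s -> _] := finP _ (measurable_obsP k a b c (measurable_btw a b c)).
have [t -> _] := finP _ (measurable_obsP k b a c (measurable_btw a b c)).
rewrite -EFinM -!EFinD !lee_fin /= => h1 h2 h3 [h4].
(* The bound [u <= 1 / 16] leaves half of [p]. *)
have : 8 * u * p <= 1 / 2 * p by rewrite ler_wpM2r//; have := u16; lra.
lra.
Qed.

(** A starting bin and a triple of labels. With [3 * n] starting bins every window of 15 bins ends
    within the [4 * n] available, as [15 <= n]. *)
Let I : finType := ('I_(3 * n) * ('I_n * ('I_n * 'I_n)))%type.
Let dist (i : I) := distinct3 i.2.1 i.2.2.1 i.2.2.2.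
Let badi (i : I) : set T := bad i.1 i.2.1 i.2.2.1 i.2.2.2.

Let measurable_badi i : measurable (badi i).
Proof. exact: measurable_bad. Qed.

Let card_dist : (3 * n * (n * (n.-1 * n.-2)) <= #|[pred i | dist i]|)%N.
Proof.
apply: (@leq_trans #|[predX 'I_(3 * n) &
    [pred j : 'I_n * ('I_n * 'I_n) | distinct3 j.1 j.2.1 j.2.2]]|).
  by rewrite cardX card_ord leq_mul2l card_distinct3 orbT.
by apply: subset_leq_card; apply/fintype.subsetP => i; rewrite !inE.
Qed.

Let window_fits k : (k < 3 * n)%N -> (k + 15 <= 4 * n)%N.
Proof. by move=> k3n; have := n15; lia. Qed.

(** The exchange of the first two labels is an involution of the index set, so twice the sum is a
    sum of the pairs bounded in [bad_pair_ge]. *)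
Let bad_sum_ge :
  3 / 512 * expR (- 5) * n%:R <= \sum_(i | dist i) fine (P (badi i)).
Proof.
pose sw (i : I) : I := (i.1, (i.2.2.1, (i.2.1, i.2.2.2))).
have swK : involutive sw by case=> k [a [b c]].
have dist_sw i : dist (sw i) = dist i.
  by rewrite /dist /distinct3 /= eq_sym; case: (_ == _) => //=; rewrite andbC.
pose S := \sum_(i | dist i) fine (P (badi i)).
have S2 : S + S = \sum_(i | dist i) (fine (P (badi i)) + fine (P (badi (sw i)))).
  rewrite big_split/=; congr (_ + _); rewrite /S (reindex_inj (inv_inj swK)).
  by apply: eq_bigl => i; rewrite dist_sw.
have : expR (- 5) * dlt ^+ 3 / 2 * #|[pred i | dist i]|%:R <= S + S.
  rewrite S2 mulr_natr -sumr_const; apply: ler_sum => i di.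
  by apply: bad_pair_ge => //; exact: window_fits.
have : (3 * n%:R * (n%:R * ((n%:R - 1) * (n%:R - 2)))) <= #|[pred i | dist i]|%:R :> R.
  move: card_dist; rewrite -(ler_nat R) !natrM; apply: le_trans.
  by rewrite -[n.-2]subn2 -[n.-1]subn1 !natrB//; exact: leq_trans n15.
have n15R : 15 <= n%:R :> R by rewrite ler_nat.
rewrite -/S; move: (#|_|%:R : R) => N h1 h2.
have e0 : 0 < expR (- 5) :> R by exact: expR_gt0.
have dn : dlt * n%:R = 1 / 4.
  by rewrite /dlt; field; rewrite pnatr_eq0 -lt0n.
have d0 : 0 < dlt by rewrite invr_gt0 mulr_gt0// ltr0n.
(* From [(n - 1) * (n - 2) >= n^2 / 2]. *)
have h3 : 3 / 2 * n%:R ^+ 4 <= N.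
  apply: le_trans h1; move: (n%:R : R) n15R => x x15.
  rewrite (_ : 3 / 2 * x ^+ 4 = 3 * x * (x * (x ^+ 2 / 2))); last by field.
  by rewrite !ler_wpM2l//; nra.
have : expR (- 5) * dlt ^+ 3 / 2 * (3 / 2 * n%:R ^+ 4) <= S + S.
  apply: le_trans h2; rewrite ler_wpM2l//.
  by rewrite mulr_ge0// mulr_ge0 ?exprn_ge0// ltW.
(* As [(dlt * n)^3 = 1 / 64], the doubled sum is at least [3 / 256 * expR (- 5) * n]. *)
rewrite (_ : _ * (3 / 2 * n%:R ^+ 4) = 3 / 4 * expR (- 5) * n%:R * (dlt * n%:R) ^+ 3); last by field.
rewrite dn; lra.
Qed.

Let kappa : R := u / (3 * Num.sqrt n%:R).

(** For fixed [w], the misplaced planted triples form a family to which [frobenius_bad_triples]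
    applies; [kappa] is the resulting cost per triple. *)
Let ell2_bad w :
  kappa * \sum_(i | dist i) \1_(badi i) w <= ell2 (X w) (Pihat (Y w)).
Proof.
pose C : {set I} := [set i | dist i && (w \in badi i)]%SET.
have CE i : i \in C -> dist i /\ badi i w.
  by rewrite finset.inE => /andP[di /set_mem].
have -> : \sum_(i | dist i) \1_(badi i) w = #|C|%:R :> R.
  rewrite -sum1_card natr_sum (eq_bigl (fun i => dist i && (w \in badi i))); last first.
    by move=> i; rewrite finset.inE.
  by rewrite [RHS]big_mkcondr/=; apply: eq_bigr => i _; rewrite indicE; case: (_ \in _).
have uniqC i j : i \in C -> j \in C -> i.2.1 = j.2.1 \/ i.2.2.2 = j.2.2.2 -> i = j.
  move=> /CE[di [pli _]] /CE[dj [plj _]] eij.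
  have [] := planted_uniq n0 di dj pli plj eij.
  move: i j {di dj pli plj eij} => [k [a [b c]]] [k' [a' [b' c']]] /= /val_inj -> -> -> -> //.
apply: ell2_ge => M rM.
rewrite /kappa mulrAC -(ord_ofK (estPihat.2 (Y w))).
apply: (@frobenius_bad_triples _ _ _ _ (fun i => i.2.1) (fun i => i.2.2.1) (fun i => i.2.2.2)) => //.
- exact: ltW.
- by move=> i j iC jC ij; apply: uniqC => //; left.
- by move=> i j iC jC ij; apply: uniqC => //; right.
- by move=> i /CE[/and3P[]].
- move=> i /CE[di [pl _]]; have [Xab Xbc Xac _] := planted_signal n0 u di pl.
  by split => //; rewrite /X signal_sym.
- by move=> i /CE[_ [_ /negP]].
Qed.

(** The pointwise bound is linear in the indicators, so its expectation is [kappa] times the sum in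
    [bad_sum_ge]; the factors 3 cancel and [n / sqrt n = sqrt n]. *)
Lemma expected_ell2_ge :
  ((expR (- 5) / 512 * u * Num.sqrt n%:R)%:E <=
     'E_P[fun w => ell2 (X w) (Pihat (Y w))])%E.
Proof.
have k0 : 0 <= kappa by rewrite divr_ge0 ?mulr_ge0 ?sqrtr_ge0 ?ltW.
rewrite unlock.
apply: (@le_trans _ _ (\int[P]_w (\sum_(i <- enum dist) (kappa * \1_(badi i) w)%:E))%E); last first.
  apply: ge0_le_integralT => w.
    by apply: sume_ge0 => i _; rewrite lee_fin mulr_ge0.
  by rewrite sumEFin lee_fin big_enum/= -mulr_sumr; exact: ell2_bad.
rewrite ge0_integral_sum//; last 2 first.
- move=> i; apply/measurable_EFinP; apply: measurable_funM => //.
- by move=> i w _; rewrite lee_fin mulr_ge0.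
have intb i : (\int[P]_w (kappa * \1_(badi i) w)%:E = (kappa * fine (P (badi i)))%:E)%E.
  under eq_integral do rewrite EFinM.
  rewrite ge0_integralZl//; last exact/measurable_EFinP/measurable_indic.
  by rewrite integral_indic// setIT [RHS]EFinM fineK// fin_num_measure.
under eq_bigr do rewrite intb.
rewrite sumEFin lee_fin big_enum/= -mulr_sumr.
apply: le_trans (ler_wpM2l k0 bad_sum_ge).
have sn0 : 0 < Num.sqrt n%:R :> R by rewrite sqrtr_gt0 ltr0n.
rewrite -[X in _ <= _ * (_ * X)](sqr_sqrtr (ler0n R n)) /kappa.
by rewrite le_eqVlt; apply/orP; left; apply/eqP; field; rewrite gt_eqF.
Qed.

End random_seriation.

Theorem theorem14 (R : realType) :
  exists c0 c1 N0 : R, [/\ 0 < c0, 0 < c1, 0 < N0 &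
  forall u : R, 0 < u -> u <= c0 ->
  forall n0 : R, N0 <= n0 ->
  exists n : nat, [/\ n0 / 2 <= n%:R, n%:R <= 2 * n0 &
  forall (d : measure_display) (T : measurableType d) (P : probability T R)
    (V : 'I_n -> {RV P >-> R}) (E : 'I_n -> 'I_n -> {RV P >-> R}),
  mutually_independent P V ->
  (forall i (A : set R), measurable A ->
     distribution P (V i) A = uniform_prob (@ltr01 R) A) ->
  mutually_independent P (fun ij : 'I_n * 'I_n => E ij.1 ij.2) ->
  (forall i j (A : set R), measurable A ->
     distribution P (E i j) A = normal_prob 0 1 A) ->
  independent P (fun w => \row_i V i w) (fun w => \matrix_(i, j) E i j w) ->
  let X := fun w => signal u (fun i => V i w) in
  let Y := fun w => X w + \matrix_(i, j) E i j w in
  forall Pihat : 'M[R]_n -> 'M[R]_n, estimator Pihat ->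
  ((c1 * u * Num.sqrt n%:R)%:E <=
     'E_P[fun w => ell2 (X w) (Pihat (Y w))])%E ] ].
Proof.
(* The first constant ensures [8 * u <= 1 / 2]; the last makes the integer part of [n0] at least
   15. *)
exists (1 / 16), (expR (- 5) / 512), 16; split => //.
(* The integer part exceeds [n0 - 1], which is at least [n0 / 2]. *)
move=> u u0 u16 n0 n016; exists (Num.truncn n0).
have n00 : 0 <= n0 by lra.
have /andP[n1 n2] := truncn_itv n00.
rewrite -natr1 in n2.
split; [lra|lra|].
move=> d T P V E indV unifV indE gaussE indVE X Y Pihat est.
apply: expected_ell2_ge => //.
by rewrite truncn_ge_nat//; lra.
Qed.
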